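(* Suppose the field $F$ is countable and $A$ is a completely integrally closed local subring of $F$ that is not a valuation ring of $F$. If $X\subseteq \operatorname{Zar}(F)$ is a representation of $A$ such that $J(X)\neq 0$, then $\lim(X)$ contains a patch closed representation of $A$ that is homeomorphic in the patch topology to the Cantor set.
   Context: A valuation ring of the field $F$ is a subring $V$ of $F$ such that for each $0\ne t\in F$, $t\in V$ or $t^{-1}\in V$ (so $F$ itself is one); $\mathfrak M_V$ denotes its maximal ideal, and $\operatorname{Zar}(F)$ is the set of all valuation rings of $F$. For nonempty $X\subseteq\operatorname{Zar}(F)$ put $A(X)=\bigcap_{V\in X}V$ and $J(X)=\bigcap_{V\in X}\mathfrak M_V$. A representation of a subring $A$ of $F$ is a subset $Y$ of $\operatorname{Zar}(F)$ with $A=A(Y)$. The patch topology on $\operatorname{Zar}(F)$ is the topology having as a basis the sets $\{V: x_1,\dots,x_n\in V,\ y_1\notin V,\dots,y_m\notin V\}$ with $x_i,y_j\in F$, $n,m\ge 0$ (it is compact Hausdorff). Patch closed means closed in $\operatorname{Zar}(F)$ in this topology. $\lim(X)$ is the set of limit points of $X$ in $\operatorname{Zar}(F)$ in the patch topology, i.e. those $U\in\operatorname{Zar}(F)$ such that every patch open neighborhood of $U$ contains a point of $X$ different from $U$. A local ring is a commutative ring with a unique maximal ideal (not necessarily Noetherian). A domain $A$ with quotient field $Q(A)$ is completely integrally closed if every $t\in Q(A)$ for which there is $0\neq a\in A$ with $at^n\in A$ for all $n>0$ lies in $A$. *)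

(* Defs.v *)
From HB Require Import structures.
From mathcomp Require Import all_boot all_algebra.
From mathcomp Require Import boolp classical_sets functions cardinality.
From mathcomp Require Import topology cantor.

Set Implicit Arguments.
Unset Strict Implicit.
Unset Printing Implicit Defensive.

Import GRing.Theory.
Local Open Scope classical_set_scope.
Local Open Scope ring_scope.

Section subrings.
Context {F : fieldType}.
Implicit Types A I M V : set F.

Definition subring A := subring_closed (mem A).

Definition ideal A I :=
  [/\ I `<=` A, I 0, (forall x y, I x -> I y -> I (x + y)) &
      forall a x, A a -> I x -> I (a * x)].

Definition maximal_ideal A M :=
  [/\ ideal A M, M <> A &
      forall I, ideal A I -> M `<=` I -> I = M \/ I = A].

Definition local_subring A := subring A /\ exists! M, maximal_ideal A M.

(* Q(A), realised inside F *)
Definition quotient_field A : set F :=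
  [set t | exists a b, [/\ A a, A b, b != 0 & t = a / b]].

Definition completely_integrally_closed A :=
  forall t, quotient_field A t ->
    (exists a, [/\ a != 0, A a & forall n, (0 < n)%N -> A (a * t ^+ n)]) ->
    A t.

Definition valuation_ring V :=
  subring V /\ forall t, t != 0 -> V t \/ V t^-1.

End subrings.

Record Zar (F : fieldType) := MkZar {
  zval : set F;
  zar_valuation : valuation_ring zval
}.

HB.instance Definition _ (F : fieldType) := gen_eqMixin (Zar F).
HB.instance Definition _ (F : fieldType) := gen_choiceMixin (Zar F).

Lemma zar_inj (F : fieldType) : injective (@zval F).
Proof.
move=> [V hV] [W hW] /= eVW; rewrite eVW in hV *.
by congr MkZar; exact: Prop_irrelevance.
Qed.

(* Basic open sets of the patch topology: the elements of the first list are
   in V, those of the second list are not; either list may be empty. *)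
Definition patch_basic (F : fieldType) (xy : seq F * seq F) : set (Zar F) :=
  [set V : Zar F | (forall x, x \in xy.1 -> zval V x) /\
                   (forall y, y \in xy.2 -> ~ zval V y)].

Lemma patch_basic_cover (F : fieldType) :
  \bigcup_(xy in [set: seq F * seq F]) patch_basic xy = setT.
Proof.
by apply/seteqP; split=> // V _; exists ([::], [::]).
Qed.

Lemma patch_basic_join (F : fieldType) (i j : seq F * seq F) (V : Zar F) :
  setT i -> setT j -> patch_basic i V -> patch_basic j V ->
  exists k, [/\ setT k, patch_basic k V &
                patch_basic k `<=` patch_basic i `&` patch_basic j].
Proof.
move=> _ _ [i1 i2] [j1 j2]; exists (i.1 ++ j.1, i.2 ++ j.2); split=> //.
  split=> x /=; rewrite mem_cat => /orP[];
    [exact: i1|exact: j1|exact: i2|exact: j2].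
move=> W [/= W1 W2]; split; split=> x xi; (apply: W1 || apply: W2);
  by rewrite mem_cat xi ?orbT.
Qed.

HB.instance Definition _ (T : choiceType) := isPointed.Build (seq T) [::].

HB.instance Definition _ (F : fieldType) := @isBaseTopological.Build (Zar F)
  (seq F * seq F)%type setT (@patch_basic F) (@patch_basic_cover F)
  (@patch_basic_join F).

Section representations.
Context {F : fieldType}.
Implicit Types (V : Zar F) (X Y : set (Zar F)) (A : set F).

(* The description of M_V by non-units is max_idealE; that M_V is the only
   maximal ideal of V is max_ideal_unique. *)
Definition max_ideal V : set F := get (maximal_ideal (zval V)).

Definition A_ X : set F := \bigcap_(V in X) zval V.

Definition J_ X : set F := \bigcap_(V in X) max_ideal V.

Definition representation A Y := Y !=set0 /\ A = A_ Y.

End representations.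

Definition homeomorphic (S T : topologicalType) :=
  exists (f : S -> T) (g : T -> S),
    [/\ cancel f g, cancel g f, continuous f & continuous g].

Section max_ideal_theory.
Context {F : fieldType}.
Implicit Type V : Zar F.

Let zar1 V : zval V 1.
Proof. by case: (zar_valuation V) => -[/set_mem]. Qed.

Let zarB V x y : zval V x -> zval V y -> zval V (x - y).
Proof.
case: (zar_valuation V) => -[_ VB _] _ Vx Vy.
by apply/set_mem/VB; exact/mem_set.
Qed.

Let zarM V x y : zval V x -> zval V y -> zval V (x * y).
Proof.
case: (zar_valuation V) => -[_ _ VM] _ Vx Vy.
by apply/set_mem/VM; exact/mem_set.
Qed.

Let zar0 V : zval V 0.
Proof. by rewrite -(subrr 1); exact: zarB. Qed.

Let zarD V x y : zval V x -> zval V y -> zval V (x + y).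
Proof.
move=> Vx Vy; rewrite -(opprK y); apply: zarB => //.
by rewrite -sub0r; exact: zarB.
Qed.

Let nonunits V : set F := [set x | zval V x /\ (x != 0 -> ~ zval V x^-1)].

Let ideal_nonunits V I : ideal (zval V) I -> I <> zval V -> I `<=` nonunits V.
Proof.
move=> [IV I0 ID IM] IneqV x Ix; split=> [|x0 Vxi]; first exact: IV.
apply: IneqV; apply/seteqP; split=> // v Vv.
have I1 : I 1 by rewrite -(mulVf x0); exact: IM.
by rewrite -(mulr1 v); exact: IM.
Qed.

Let nonunitsM V a x : zval V a -> nonunits V x -> nonunits V (a * x).
Proof.
move=> Va [Vx Nx]; split=> [|]; first exact: zarM.
rewrite mulf_eq0 negb_or => /andP[a0 x0] Vax; apply: (Nx x0).
have -> : x^-1 = a * (a * x)^-1 by rewrite invfM mulrA mulfV ?mul1r.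
exact: zarM.
Qed.

Let nonunitsD V x y : nonunits V x -> nonunits V y -> nonunits V (x + y).
Proof.
have [->|x0] := eqVneq x 0; first by rewrite add0r.
have [->|y0] := eqVneq y 0; first by rewrite addr0.
move=> Nx Ny; have xy0 : x / y != 0 by rewrite mulf_neq0 ?invr_eq0.
have [Vxy|] := (zar_valuation V).2 _ xy0.
  have -> : x + y = (x / y + 1) * y by rewrite mulrDl mul1r divfK.
  by apply: nonunitsM => //; exact: zarD.
rewrite invf_div => Vyx.
have -> : x + y = (1 + y / x) * x by rewrite mulrDl mul1r divfK.
by apply: nonunitsM => //; exact: zarD.
Qed.

Let maximal_nonunits V : maximal_ideal (zval V) (nonunits V).
Proof.
have N1 : ~ nonunits V 1.
  by case=> _ /(_ (oner_neq0 _)); rewrite invr1; apply.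
split; [split| |].
- by move=> x [].
- by split=> //; rewrite eqxx.
- exact: nonunitsD.
- exact: nonunitsM.
- by move=> NV; apply: N1; rewrite NV.
- move=> I idI NI; have [->|IV] := pselect (I = zval V); first by right.
  by left; apply/seteqP; split=> //; exact: ideal_nonunits.
Qed.

Lemma max_ideal_unique V M : maximal_ideal (zval V) M <-> M = max_ideal V.
Proof.
have uniq I : maximal_ideal (zval V) I -> I = nonunits V.
  move=> [idI IV maxI].
  have [idN NV _] := maximal_nonunits V.
  have [//|/NV[]] := maxI _ idN (ideal_nonunits idI IV); exact: esym.
have maxP : maximal_ideal (zval V) (max_ideal V).
  by apply: getI; exact: maximal_nonunits.
by split=> [/uniq ->|-> //]; rewrite (uniq _ maxP).
Qed.

Lemma max_idealE V :
  max_ideal V = [set x | zval V x /\ (x != 0 -> ~ zval V x^-1)].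
Proof. by apply/esym/max_ideal_unique; exact: maximal_nonunits. Qed.

End max_ideal_theory.

(* Main.v *)
Require Import Defs.
From HB Require Import structures.
From mathcomp Require Import all_boot all_algebra.
From mathcomp Require Import boolp classical_sets functions cardinality.
From mathcomp Require Import topology cantor.

Set Implicit Arguments.
Unset Strict Implicit.
Unset Printing Implicit Defensive.

Import GRing.Theory.
Local Open Scope classical_set_scope.
Local Open Scope ring_scope.

(** Inside the closure of X, Zorn's lemma and compactness of the patch topology
    give a closed set Y minimal among the closed sets with A(Y) = A. Such a Y
    has no isolated point, and this is where the hypotheses on A enter.
    Suppose that U is isolated in Y, so that C = Y \ {U} is closed, and let
    0 <> j in J(Y) (passing to the closure preserves J). Take b in A(C). If
    s = j b^n were outside U for some n, then t = 1/(1+s) would be a nonunit of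
    U but congruent to 1 modulo the maximal ideal of each V in C. Both t and
    1 - t would then be nonunits of A, which is absurd in a local ring
    ([pow_mul_J_mem]). So j b^n lies in A for all n; as b = (j b)/j is in the
    quotient field of A, complete integral closedness puts b in A
    ([isolated_redundant]). Hence A(C) = A, against minimality. That C is
    nonempty comes from A not being the valuation ring U.

    Thus Y consists of limit points of Y, hence of X. It is compact and
    perfect, and since F is countable, the clopen sets {V : t in V} form a
    countable family that separates its points; such a space is homeomorphic
    to the Cantor set ([clopen_separated_cantor]). *)

(** * Local subrings of a field *)

Section subring_theory.
Context {F : fieldType}.
Implicit Types (A I M : set F) (x y : F).

Lemma subring1 A : subring A -> A 1.
Proof. by case=> /set_mem. Qed.

Lemma subringB A x y : subring A -> A x -> A y -> A (x - y).
Proof. by case=> _ AB _ Ax Ay; apply/set_mem/AB; exact/mem_set. Qed.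

Lemma subringM A x y : subring A -> A x -> A y -> A (x * y).
Proof. by case=> _ _ AM Ax Ay; apply/set_mem/AM; exact/mem_set. Qed.

Lemma subring0 A : subring A -> A 0.
Proof.
by move=> sA; rewrite -(subrr 1); apply: subringB => //; exact: subring1.
Qed.

Lemma subringD A x y : subring A -> A x -> A y -> A (x + y).
Proof.
move=> sA Ax Ay; rewrite -(opprK y); apply: subringB => //.
by rewrite -sub0r; apply: subringB => //; exact: subring0.
Qed.

Lemma subringX A x n : subring A -> A x -> A (x ^+ n).
Proof.
move=> sA Ax; elim: n => [|n IHn]; first exact: subring1.
by rewrite exprS; exact: subringM.
Qed.

(** Krull's theorem: the ideal x A is proper, and Zorn's lemma enlarges it. It
    is needed because locality is given as uniqueness of the maximal ideal,
    with no reference to nonunits. *)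
Lemma maximal_ideal_nonunit A x : subring A -> A x ->
  ~ (x != 0 /\ A x^-1) -> exists2 M, maximal_ideal A M & M x.
Proof.
move=> sA Ax nux.
pose proper I := [/\ ideal A I, I x & ~ I 1].
have xA_proper : proper [set a * x | a in A].
  split; first split.
  - by move=> _ [a Aa <-]; exact: subringM.
  - by exists 0; [exact: subring0|rewrite mul0r].
  - move=> _ _ [a Aa <-] [b Ab <-]; exists (a + b); last by rewrite mulrDl.
    exact: subringD.
  - move=> a _ Aa [b Ab <-]; exists (a * b); last by rewrite mulrA.
    exact: subringM.
  - by exists 1; [exact: subring1|rewrite mul1r].
  - move=> [a Aa ax1]; apply: nux.
    have x0 : x != 0.
      by apply/eqP => x0; move/eqP: ax1; rewrite x0 mulr0 eq_sym oner_eq0.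
    by split=> //; rewrite -[x^-1]mul1r -ax1 mulfK.
(* The empty set is admitted alongside the proper ideals so that the empty
   chain has an upper bound. *)
have [C chC totC|M [[M0|pM] maxM]] :=
    @Zorn_bigcup F (fun I => I = set0 \/ proper I).
- have [[I CI pI]|noI] := pselect (exists2 I, C I & proper I); last first.
    left; rewrite -subset0 => y [I CI Iy]; apply: noI; exists I => //.
    by have [I0|//] := chC _ CI; move: Iy; rewrite I0.
  have idC J y : C J -> J y -> proper J.
    by move=> CJ Jy; have [J0|//] := chC _ CJ; move: Jy; rewrite J0.
  right; split; first split.
  + by move=> y [J CJ Jy]; have [[JA _ _ _] _ _] := idC _ _ CJ Jy; exact: JA.
  + by exists I => //; case: pI => -[].
  + move=> y z [J CJ Jy] [K CK Kz]; have [JK|KJ] := totC _ _ CJ CK.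
      exists K => //; have [[_ _ KD _] _ _] := idC _ _ CK Kz.
      by apply: KD => //; exact: JK.
    exists J => //; have [[_ _ JD _] _ _] := idC _ _ CJ Jy.
    by apply: JD => //; exact: KJ.
  + move=> a y Aa [J CJ Jy]; exists J => //.
    by have [[_ _ _ JM] _ _] := idC _ _ CJ Jy; exact: JM.
  + by exists I => //; case: pI.
  + by move=> [J CJ J1]; have [_ _] := idC _ _ CJ J1; apply.
- case: (maxM [set a * x | a in A]); last by right.
  rewrite M0; split=> // /(_ x); apply.
  by have [_ xAx _] := xA_proper.
- have [idM Mx M1] := pM; exists M => //; split=> // [MA|I idI MI].
    by apply: M1; rewrite MA; exact: subring1.
  have [I1|I1] := pselect (I 1).
    right; have [IA _ _ IM] := idI; apply/seteqP; split=> // a Aa.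
    by rewrite -(mulr1 a); exact: IM.
  left; apply: contrapT => IneM; apply: (maxM I).
    by split=> // IM; apply: IneM; exact/seteqP.
  by right; split=> //; exact: MI.
Qed.

(** Otherwise x and 1 - x would both lie in the maximal ideal, and so would
    their sum 1. *)
Lemma local_unit A x : local_subring A -> A x ->
  (x != 0 /\ A x^-1) \/ (1 - x != 0 /\ A (1 - x)^-1).
Proof.
move=> [sA [M [maxM uniqM]]] Ax; apply: contrapT => /not_orP[nu nu'].
have [N maxN Nx] := maximal_ideal_nonunit sA Ax nu.
have [N' maxN' N'x] :=
  maximal_ideal_nonunit sA (subringB sA (subring1 sA) Ax) nu'.
have [[MA _ MD MM] MneA _] := maxM; apply: MneA; apply/seteqP; split=> // a Aa.
rewrite -(mulr1 a); apply: MM => //; rewrite -(subrK x 1); apply: MD.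
  by rewrite (uniqM _ maxN').
by rewrite (uniqM _ maxN).
Qed.

End subring_theory.

(** * Redundancy of one valuation ring in a representation *)

Section valuation_theory.
Context {F : fieldType}.
Implicit Types (U V : Zar F) (C : set (Zar F)) (A : set F) (x : F).

Lemma zval_subring V : subring (zval V).
Proof. by case: (zar_valuation V). Qed.

Lemma zval_inv V x : x != 0 -> ~ zval V x -> zval V x^-1.
Proof. by move=> x0 Vx; have [] := (zar_valuation V).2 _ x0. Qed.

Lemma max_ideal_ideal V : ideal (zval V) (max_ideal V).
Proof. by have [] := (max_ideal_unique V (max_ideal V)).2 erefl. Qed.

Lemma max_ideal_inv V x : x != 0 -> max_ideal V x -> ~ zval V x^-1.
Proof. by move=> x0; rewrite max_idealE => -[_]; exact. Qed.

Lemma max_ideal1 V : ~ max_ideal V 1.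
Proof.
move=> /(max_ideal_inv (oner_neq0 _)); rewrite invr1; apply.
by apply: subring1; exact: zval_subring.
Qed.

(** When 1 + x = 0 the inverse is 0 by convention; that case is vacuous, but
    the convention saves a side condition. *)
Lemma zval_inv1D V x : max_ideal V x -> zval V (1 + x)^-1.
Proof.
move=> Mx; have [MV _ MD MM] := max_ideal_ideal V.
have sV := zval_subring V.
have [->|x1] := eqVneq (1 + x) 0; first by rewrite invr0; exact: subring0.
apply: contrapT => Vx1; apply: (@max_ideal1 V).
have M1x : max_ideal V (1 + x).
  by rewrite max_idealE; split=> //; exact: subringD sV (subring1 sV) (MV _ Mx).
rewrite -(addrK x 1) -mulN1r; apply: MD => //; apply: MM => //.
by rewrite -sub0r; exact: subringB sV (subring0 sV) (subring1 sV).
Qed.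

(** If s = j b^n is outside U, then 1/(1+s) is a nonunit of U and a unit of
    every V in C, while its complement s/(1+s) is a nonunit of every V in C.
    These are two nonunits of A with sum 1. *)
Lemma pow_mul_J_mem U C A j b :
  local_subring A -> A = zval U `&` A_ C -> C !=set0 ->
  J_ C j -> A_ C b -> forall n, zval U (j * b ^+ n).
Proof.
move=> lA AUC [V0 CV0] Jj Bb n; set s := j * b ^+ n.
apply: contrapT => Us.
have Ms V : C V -> max_ideal V s.
  move=> CV; have [_ _ _ MM] := max_ideal_ideal V; rewrite /s mulrC.
  by apply: MM; [apply: subringX (zval_subring V) _; exact: Bb|exact: Jj].
have sU := zval_subring U; have sA : subring A by case: lA.
have s0 : s != 0 by apply/eqP => s0; apply: Us; rewrite s0; exact: subring0.
have Us1 : ~ zval U (1 + s).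
  move=> Us1; apply: Us; rewrite -(addKr 1 s) addrC.
  exact: subringB sU Us1 (subring1 sU).
have s1 : 1 + s != 0.
  by apply/eqP => s1; apply: Us1; rewrite s1; exact: subring0.
pose t := (1 + s)^-1.
have At : A t.
  rewrite AUC; split; first exact: zval_inv.
  by move=> V CV; exact/zval_inv1D/Ms.
have t1E : 1 - t = s * t.
  have s1t : (1 + s) * t = 1 by exact: mulfV.
  by rewrite -[X in X - _]s1t mulrDl mul1r addrAC subrr add0r.
have [[_]|[t1]] := local_unit lA At.
  by rewrite invrK AUC => -[].
rewrite AUC => -[_ /(_ _ CV0)]; apply: max_ideal_inv => //.
have [_ _ _ MM] := max_ideal_ideal V0.
by rewrite t1E mulrC; apply: MM; [exact/zval_inv1D/Ms|exact: Ms].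
Qed.

(** The element j is a common denominator for all powers of an element b of
    A(C), so complete integral closedness applies to b. That b belongs to the
    quotient field of A is part of the same fact: both j b and j are in A. *)
Lemma isolated_redundant U C A j :
  local_subring A -> completely_integrally_closed A -> ~ valuation_ring A ->
  A = zval U `&` A_ C -> j != 0 -> zval U j -> J_ C j -> A_ C = A.
Proof.
move=> lA cicA nvA AUC j0 Uj Jj.
have [C0|/set0P/negP/negPn/eqP C0] := pselect (C !=set0); last first.
  exfalso; apply: nvA; suff -> : A = zval U by exact: zar_valuation.
  by rewrite AUC C0 /A_ bigcap_set0 setIT.
apply/seteqP; split; last by rewrite AUC => x [].
move=> b Bb.
have Ajb n : A (j * b ^+ n).
  rewrite AUC; split; first exact: pow_mul_J_mem lA AUC C0 Jj Bb n.
  move=> V CV; have sV := zval_subring V.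
  have [MV _ _ _] := max_ideal_ideal V.
  by apply: subringM (MV _ (Jj _ CV)) _ => //; apply: subringX => //; exact: Bb.
have Aj : A j by have := Ajb 0%N; rewrite mulr1.
apply: cicA; last by exists j.
exists (j * b), j; split=> //; last by rewrite mulrC mulKf.
exact: Ajb 1%N.
Qed.

End valuation_theory.

(** * A characterization of the Cantor set *)

Lemma clopen_separated_hausdorff (T : topologicalType) (I : Type)
    (S : I -> set T) :
  (forall i, clopen (S i)) ->
  (forall x y, x <> y -> exists i, ~ (S i x <-> S i y)) -> hausdorff_space T.
Proof.
move=> clS sepS; rewrite open_hausdorff => x y /eqP /sepS[i].
have [oS /closed_openC oC] := clS i.
have [Sx|nSx] := pselect (S i x); have [Sy|nSy] := pselect (S i y) => sepi.
- by case: sepi.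
- by exists (S i, ~` S i); rewrite ?setICr; split=> //; exact/mem_set.
- by exists (~` S i, S i); rewrite ?setICl; split=> //; exact/mem_set.
- by case: sepi.
Qed.

Section cantor_characterization.
Context {T : topologicalType} (S : nat -> set T).
Hypothesis clopenS : forall n, clopen (S n).
Hypothesis separatedS : forall x y, x <> y -> exists n, ~ (S n x <-> S n y).
Hypothesis perfectT : perfect_set [set: T].
Hypothesis compactT : compact [set: T].

Let splits n (W : set T) := S n `&` W !=set0 /\ ~` S n `&` W !=set0.

(* The n-th step of the subdivision cuts W with S n whenever this is possible,
   so that S n separates the pieces after that step; otherwise another member
   of the family cuts W, since W has two points by perfectness. *)
Let split_index n W : {m | (splits n W -> m = n) /\
                           (open W -> W !=set0 -> splits m W)}.
Proof.
apply: cid; have [sW|nsW] := pselect (splits n W); first by exists n.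
have [[oW W0]|nW] := pselect (open W /\ W !=set0); last first.
  by exists n; split=> // oW W0; case: nW.
have [x [y [Wx Wy /eqP/separatedS[m sepm]]]] := perfectTP_ex.1 perfectT _ oW W0.
exists m; split=> // _ _.
have [Sx|nSx] := pselect (S m x); have [Sy|nSy] := pselect (S m y).
- by case: sepm.
- by split; [exists x|exists y].
- by split; [exists y|exists x].
- by case: sepm.
Qed.

Let half n W (b : bool) : set T :=
  let m := sval (split_index n W) in (if b then S m else ~` S m) `&` W.

(** The nested clopen pieces obtained by halving T again and again form a binary
    tree whose branches are the points of T: each branch meets T by
    compactness, and in one point because every S n has separated. *)
Lemma clopen_separated_cantor (t0 : T) : homeomorphic T cantor_space.
Proof.
have hausT := clopen_separated_hausdorff clopenS separatedS.
(* The trees are built over pointed spaces; t0 serves as the base point. *)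
pose PT : ptopologicalType := HB.pack T (isPointed.Build T t0).
have [||||||||g [ctsg surjg injg]] := @tree_map_props (fun=> bool) PT half
  (fun W => clopen W /\ W !=set0).
- exact: compactT.
- exact: hausT.
- move=> n W; apply/seteqP; split=> [x Wx|x [b _ []//]].
  have [Sx|nSx] := pselect (S (sval (split_index n W)) x).
    by exists true.
  by exists false.
- move=> n W b [clW W0]; rewrite /half; case: (split_index n W) => m /= [_].
  move=> /(_ clW.1 W0)[S0 C0]; case: b; split=> //; apply: clopenI => //.
    exact: clopenS.
  exact: clopenC set0 (clopenS m).
- by move=> W [].
- by split; [exact: clopenT|exists t0].
- by move=> W [[]].
- move=> x y /eqP/separatedS[n sepn]; exists n => W b.
  rewrite /half; case: (split_index n W) => m /= [mE _] [bx Wx] [bY Wy].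
  have mn : m = n.
    apply: mE; have [Sx|nSx] := pselect (S n x);
      have [Sy|nSy] := pselect (S n y).
    - by case: sepn.
    - by split; [exists x|exists y].
    - by split; [exists y|exists x].
    - by case: sepn.
  by apply: sepn; rewrite -mn; case: b bx bY.
- have {}injg : set_inj [set: cantor_space] g.
    apply: injg => n W b b' _ _ [x [[+ _] [+ _]]].
    by case: b b' => -[].
  have : set_bij [set: cantor_space] [set: T] g by split.
  rewrite setTT_bijective => -[f gK fK].
  (* The inverse is continuous since a continuous map from a compact space to a
     Hausdorff space is closed. *)
  exists f, g; split=> //; apply/continuous_closedP => K clK.
  have -> : f @^-1` K = g @` K.
    apply/seteqP; split=> [x Kfx|_ [c Kc <-]]; last by rewrite /= gK.
    by exists (f x).
  apply: compact_closed => //; apply: continuous_compact.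
    exact: continuous_subspaceT.
  exact: subclosed_compact clK cantor_space_compact _.
Qed.

End cantor_characterization.

(** * Subspaces and limit points *)

Section subspace_of_type.
Context {T : topologicalType} (Y : set T).

Lemma set_val_continuous : continuous (set_val : set_type Y -> T).
Proof. exact: initial_continuous. Qed.

Lemma compact_set_type : compact Y -> compact [set: set_type Y].
Proof.
move=> cptY G PG _.
have GY : G (set_val @^-1` Y) by apply: filterE => y; exact: set_valP.
have [p [/mem_set Yp clp]] := cptY (set_val @ G) _ GY.
exists (SigSub Yp); split=> // B N GB [_ [[O oO <-] Op ON]].
have GvB : G (set_val @^-1` (set_val @` B)).
  by apply: filterS GB => y By; exists y.
have pO : nbhs p O by exact: open_nbhs_nbhs.
have [_ [[y By <-] Oy]] := clp _ _ GvB pO.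
by exists y; split=> //; exact: ON.
Qed.

Lemma perfect_set_type : Y `<=` limit_point Y -> perfect_set [set: set_type Y].
Proof.
move=> limY; apply/perfectTP => y [O oO Oy].
have Oyy : O (set_val y) by have : [set y] y by []; rewrite -Oy.
have [||z [zy Yz Oz]] := limY (set_val y) _ O; first exact: set_valP.
  exact: open_nbhs_nbhs.
have : [set y] (SigSub (mem_set Yz)) by rewrite -Oy.
by move=> /= zyE; move/eqP: zy; apply; rewrite -zyE.
Qed.

End subspace_of_type.

(** A neighbourhood of t minus the closed point t is a neighbourhood of each of
    its points, so a point of the closure there can be traded for one of X. *)
Lemma limit_point_closure (T : topologicalType) (X : set T) :
  accessible_space T -> limit_point (closure X) `<=` limit_point X.
Proof.
move=> T1 t limt N; rewrite nbhsE => -[O [oO Ot] ON].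
have [y [yt clXy Oy]] := limt _ (open_nbhs_nbhs (conj oO Ot)).
have [|x [Xx [Ox xt]]] := clXy (O `&` ~` [set t]).
  apply: open_nbhs_nbhs; split; last by split=> //; exact/eqP.
  apply: openI => //; apply: closed_openC; exact: accessible_closed_set1.
by exists x; split=> //; [exact/eqP|exact: ON].
Qed.

(** * The patch topology *)

Lemma filter_forall_seq (T : Type) (I : eqType) (G : set_system T)
    (P : I -> set T) (s : seq I) : Filter G ->
  (forall i, i \in s -> G (P i)) -> G [set x | forall i, i \in s -> P i x].
Proof.
move=> FG; elim: s => [|i s IHs] GP; first by apply: filterE.
have Gs : G [set x | forall j, j \in s -> P j x].
  by apply: IHs => j js; apply: GP; rewrite inE js orbT.
apply: filterS2 (GP i (mem_head _ _)) Gs => x Pi Ps j.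
by rewrite inE => /predU1P[->|/Ps].
Qed.

Section patch_topology.
Context {F : fieldType}.
Implicit Types (V : Zar F) (X Y : set (Zar F)) (A : set F) (t : F).

Lemma open_patch_basic xy : open (@patch_basic F xy).
Proof. by exists [set xy] => //; rewrite bigcup_set1. Qed.

Lemma nbhs_patchP V (N : set (Zar F)) :
  nbhs V N -> exists2 xy, patch_basic xy V & patch_basic xy `<=` N.
Proof.
rewrite nbhsE => -[_ [[D _ <-] [xy Dxy Vxy]] DN].
by exists xy => // W Wxy; apply: DN; exists xy.
Qed.

Lemma clopen_zval t : clopen [set V : Zar F | zval V t].
Proof.
split.
  have -> : [set V : Zar F | zval V t] = patch_basic ([:: t], [::]).
    apply/seteqP; split=> V /= => [Vt|[Vt _]]; last first.
      by apply: Vt; exact: mem_head.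
    by split=> // x; rewrite inE => /eqP ->.
  exact: open_patch_basic.
rewrite -[X in closed X]setCK; apply: open_closedC.
have -> : ~` [set V : Zar F | zval V t] = patch_basic ([::], [:: t]).
  apply/seteqP; split=> V /= => [Vt|[_ Vt]]; last first.
    by apply: Vt; exact: mem_head.
  by split=> // x; rewrite inE => /eqP ->.
exact: open_patch_basic.
Qed.

Lemma zval_separated V W : V <> W -> exists t, ~ (zval V t <-> zval W t).
Proof.
move=> VW; apply: contrapT => /forallNP VWE; apply: VW; apply: zar_inj.
by apply/seteqP; split=> t; have /contrapT[] := VWE t.
Qed.

Lemma Zar_hausdorff : hausdorff_space (Zar F).
Proof. exact: clopen_separated_hausdorff clopen_zval zval_separated. Qed.

(** An ultrafilter G converges to the set of those t that lie in V for G-almost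
    all V: this limit is a subring because G is a filter, and a valuation ring
    because G decides between t in V and t not in V. *)
Lemma Zar_compact : compact [set: Zar F].
Proof.
rewrite compact_ultra => G UG _.
have GC P : G P \/ G (~` P) by exact: in_ultra_setVsetC.
pose L : set F := [set t | G [set V | zval V t]].
have sL : subring L.
  split; first by apply/mem_set; apply: filterE => V;
    apply: subring1; exact: zval_subring.
  - move=> x y /set_mem Lx /set_mem Ly; apply/mem_set.
    by apply: filterS2 Lx Ly => V; apply: subringB; exact: zval_subring.
  - move=> x y /set_mem Lx /set_mem Ly; apply/mem_set.
    by apply: filterS2 Lx Ly => V; apply: subringM; exact: zval_subring.
have vL : valuation_ring L.
  split=> // t t0; have [|GCt] := GC [set V | zval V t]; first by left.
  by right; apply: filterS GCt => V; exact: zval_inv.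
exists (MkZar vL); split=> // N /nbhs_patchP[[xs ys] /= [Lxs Lys] xyN].
apply: filterS xyN _; apply: filterI; apply: filter_forall_seq => y.
  exact: Lxs.
by move=> /Lys nLy; have [] := GC [set V | zval V y].
Qed.

(** Zorn's lemma for decreasing chains of closed sets Z with A(Z) = A. If t is
    not in A, the sets of those V in Z that omit t are nonempty, closed and
    nested, so by compactness they have a common member; hence t is not in the
    intersection of all V in the limit of the chain either. *)
Lemma A_minimal_closed A Y : closed Y -> A_ Y = A ->
  exists Z, [/\ closed Z, Z `<=` Y, A_ Z = A &
    forall Z', closed Z' -> Z' `<=` Z -> A_ Z' = A -> Z' = Z].
Proof.
move=> clY YA.
(* The chains are made increasing by passing to open complements. *)
have [C chC totC|O [[oO OA] maxO]] := @Zorn_bigcup (Zar F)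
    (fun O => open O /\ A_ (Y `\` O) = A).
  split; first by apply: bigcup_open => O /chC[].
  apply/seteqP; split=> t; last first.
    by rewrite -YA => At V [YV _]; exact: At.
  move=> At; rewrite -YA => V0 YV0; apply: contrapT => V0t.
  have [[O0 CO0]|C0] := pselect (C !=set0); last first.
    apply: V0t; apply: At; split=> // -[O CO _]; apply: C0; by exists O.
  pose K (O : set (Zar F)) := Y `\` O `\` [set V | zval V t].
  have K0 O : C O -> K O !=set0.
    move=> /chC[oO OA]; apply: contrapT => K0; apply: V0t.
    suff : A t by rewrite -YA; exact.
    by rewrite -OA => V YOV; apply: contrapT => Vt; apply: K0; exists V.
  have PG : ProperFilter (filter_from C K).
    apply: filter_from_proper => //.
    apply: filter_from_filter; first by exists O0.
    move=> O P CO CP; have [OP|PO] := totC _ _ CO CP.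
      exists P => // V [[YV PV] Vt]; split; split=> //; split=> //.
      by move=> /OP.
    exists O => // V [[YV OV] Vt]; split; split=> //; split=> //.
    by move=> /PO.
  have [|V [_ clV]] := Zar_compact PG; first exact: filterT.
  have KV O : C O -> K O V.
    move=> CO; have clK : closed (K O).
      apply: closedI; last exact: open_closedC (clopen_zval t).1.
      by apply: closedI => //; apply: open_closedC; have [] := chC _ CO.
    apply: clK => N nN; apply: clV => //.
    by exists O.
  have [[YV _] Vt] := KV _ CO0; apply: Vt; apply: At; split=> // -[O CO OV].
  by have [[]] := KV _ CO.
exists (Y `\` O); split=> //.
  by apply: closedI => //; exact: open_closedC.
move=> Z clZ ZY ZA; apply: contrapT => ZneY; apply: (maxO (~` Z)).
  split=> [V OV /ZY[]//|ZO]; apply: ZneY; apply/seteqP; split=> // V [YV OV].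
  by apply: contrapT => /ZO.
split; first exact: closed_openC.
suff -> : Y `\` ~` Z = Z by [].
by rewrite setDE setCK; apply/setIidPr => V /ZY[].
Qed.

Lemma A_closure X : A_ (closure X) = A_ X.
Proof.
apply/seteqP; split=> [t At V XV|t At V clXV].
  by apply: At; exact: subset_closure.
have [_ /closure_id clE] := clopen_zval t.
suff : closure [set W : Zar F | zval W t] V by rewrite -clE.
by move: clXV; apply: closure_subset.
Qed.

(** That t is a nonunit of V is a closed condition on V, namely that t is in V
    and, when t is nonzero, that its inverse is not. *)
Lemma J_closure X : J_ X `<=` J_ (closure X).
Proof.
move=> t Jt V clXV; rewrite max_idealE; split=> [|t0].
  suff : A_ (closure X) t by exact.
  rewrite A_closure => W XW; have [MW _ _ _] := max_ideal_ideal W.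
  exact/MW/Jt.
have /closure_id clE : closed (~` [set W : Zar F | zval W t^-1]).
  exact: open_closedC (clopen_zval _).1.
suff : closure (~` [set W : Zar F | zval W t^-1]) V by rewrite -clE.
move: clXV; apply: closure_subset => W XW; exact: max_ideal_inv (Jt _ XW).
Qed.

End patch_topology.

(** * Cantor sets of limit points *)

Lemma countable_enum (T : Type) (t0 : T) : countable [set: T] ->
  exists e : nat -> T, forall t, exists n, e n = t.
Proof.
move=> /pfcard_geP[T0|/unsquash e].
  by have : [set: T] t0 by []; rewrite T0.
by exists e => t; have [n _ <-] := @surj _ _ _ _ e t I; exists n.
Qed.

Theorem corollary3p6 (F : fieldType) (A : set F) (X : set (Zar F)) :
  countable [set: F] ->
  local_subring A ->
  completely_integrally_closed A ->
  ~ valuation_ring A ->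
  representation A X ->
  J_ X <> [set 0] ->
  exists Y : set (Zar F),
    [/\ Y `<=` limit_point X, closed Y, representation A Y &
        homeomorphic (set_type Y) cantor_space].
Proof.
move=> cntF lA cicA nvA [_ XA] JX0.
have [j j0 Jj] : exists2 j, j != 0 & J_ X j.
  apply: contrapT => noj; apply: JX0; apply/seteqP; split=> [j Jj|_ -> V _].
    by apply: contrapT => /eqP j0; apply: noj; exists j.
  by have [_ ? _ _] := max_ideal_ideal V.
have clA : A_ (closure X) = A by rewrite A_closure.
have [Y [clY YX YA minY]] := A_minimal_closed (@closed_closure _ X) clA.
have JY V : Y V -> max_ideal V j by move=> /YX; exact: J_closure.
(* An isolated point U of Y could be removed without changing A(Y). *)
have limY : Y `<=` limit_point Y.
  move=> U YU; apply: contrapT; rewrite not_limit_pointE => -[N].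
  rewrite nbhsE => -[O [oO OU] ON] YN.
  have YUE : Y = U |` (Y `\` O).
    apply/seteqP; split=> [V YV|V [->|[]]//].
    have [OV|OV] := pselect (O V); last by right.
    by left; apply: YN; split=> //; exact: ON.
  suff YOE : Y `\` O = Y by have [] : (Y `\` O) U by rewrite YOE.
  apply: minY; [|by move=> V []|].
    by apply: closedI => //; exact: open_closedC.
  apply: isolated_redundant lA cicA nvA _ j0 _ _.
  - by rewrite -YA [in LHS]YUE /A_ bigcap_setU1.
  - by have [MU _ _ _] := max_ideal_ideal U; exact/MU/JY.
  - by move=> V [YV _]; exact: JY.
have [V0 YV0] : Y !=set0.
  apply/set0P/eqP => Y0; apply: nvA; rewrite -YA Y0 /A_ bigcap_set0.
  (* The empty intersection is F, a valuation ring. *)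
  split; last by left.
  by split=> [|x y _ _|x y _ _]; exact: mem_set.
exists Y; split=> //.
- move=> V /limY limV; apply: limit_point_closure.
    exact/hausdorff_accessible/Zar_hausdorff.
  by move=> N /limV[W [WV YW NW]]; exists W; split=> //; exact: YX.
- by split; [exists V0|].
have [e esurj] := countable_enum 0 cntF.
pose S n : set (set_type Y) := [set V | zval (set_val V) (e n)].
apply: (@clopen_separated_cantor _ S) (SigSub (mem_set YV0)).
- move=> n; exact: preimage_clopen (clopen_zval _) (@set_val_continuous _ _).
- move=> V W VW; have [|t sept] := @zval_separated _ (set_val V) (set_val W).
    by move=> /val_inj.
  by have [n et] := esurj t; exists n; rewrite /S /= et.
- exact: perfect_set_type.
- by apply: compact_set_type; exact: subclosed_compact clY Zar_compact _.
Qed.
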